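(* Every proper edge-biregular map $(H;r_0,r_2,\rho_0,\rho_2)$ on the torus is, up to duality and twinness, determined by a group $H$ with one of the two following presentations: $$H_{Rect}=\langle r_0,r_2,\rho_0,\rho_2\mid r_0^2,r_2^2,\rho_0^2,\rho_2^2,(r_0r_2)^2,(\rho_0\rho_2)^2,(r_0\rho_0)^2,(r_2\rho_2)^2,(r_0\rho_2)^a,(r_2\rho_0)^c\rangle$$ or $$H_{Rhomb}=\langle r_0,r_2,\rho_0,\rho_2\mid r_0^2,r_2^2,\rho_0^2,\rho_2^2,(r_0r_2)^2,(\rho_0\rho_2)^2,(r_0\rho_0)^2,(r_2\rho_2)^2,(r_0\rho_2)^{2b},(r_0\rho_2)^b(r_2\rho_0)^c\rangle,$$ where $a$, $b$ and $c$ are positive integers.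
   Context: A map is an embedding of a connected graph in a surface such that each face is homeomorphic to an open disc; semi-edges (edges with only one end attached to a vertex, the other end dangling) are in general allowed. An alternate-edge-colouring of a map is a colouring of its edges with two colours (shaded, unshaded) such that consecutive edges around every face, and consecutive edges around every vertex, have different colours. Flags are the faces of the barycentric subdivision; a corner is the pair of flags of one face which meet at a corner of that face, and consists of one flag of each colour. A map with an assigned alternate-edge-colouring is edge-biregular if its group $H$ of colour-preserving (and structure-preserving) automorphisms acts regularly on the set of corners. Fixing a marked corner, $H$ is generated by involutions $r_0,r_2,\rho_0,\rho_2$ taking the marked corner to its neighbour respectively along the shaded edge, across the shaded edge, along the unshaded edge, across the unshaded edge. The map is written $(H;r_0,r_2,\rho_0,\rho_2)$; in $H$ one has $(r_0r_2)^2=(\rho_0\rho_2)^2=1$, and the map has type $(k,l)$ (vertex valency $k$, face length $l$) where $r_2\rho_2$ has order $k/2$ and $r_0\rho_0$ has order $l/2$. The group with its four ordered generators determines the map up to isomorphism. The map is proper if it has no semi-edges, i.e. $r_0\ne r_2$ and $\rho_0\neq\rho_2$. The twin of $(H;r_0,r_2,\rho_0,\rho_2)$ is $(H;\rho_0,\rho_2,r_0,r_2)$ (colours switched); its dual is $(H;r_2,r_0,\rho_2,\rho_0)$ (vertices and faces interchanged). *)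

(* Defs.v *)
From HB Require Import structures.
From mathcomp Require Import all_boot all_order all_algebra all_fingroup.

Set Implicit Arguments.
Unset Strict Implicit.
Unset Printing Implicit Defensive.

Import GroupScope.

(* A map on a closed connected surface, given by its flags: [flip0 x], [flip1 x]
   and [flip2 x] are the flags sharing a side of the barycentric subdivision
   with [x] and differing from it in the vertex, the edge and the face
   respectively.  On a semi-edge, moving along the edge goes round its dangling
   end to the other side of it, so there [flip0 x = flip2 x].  The flips have no
   fixed points because the surface has no boundary, and there are finitely many
   flags because it is compact. *)
Record surface_map := SurfaceMap {
  flag :> finType;
  flip0 : {perm flag};
  flip1 : {perm flag};
  flip2 : {perm flag};
  flip0K : involutive flip0;
  flip1K : involutive flip1;
  flip2K : involutive flip2;
  flip0_free : forall x, flip0 x != x;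
  flip1_free : forall x, flip1 x != x;
  flip2_free : forall x, flip2 x != x;
  flip02C : forall x, flip0 (flip2 x) = flip2 (flip0 x);
  flip_connected :
    [transitive <<[set flip0; flip1; flip2]>>, on [set: flag] | 'P]
}.

Arguments flip0 : clear implicits.
Arguments flip1 : clear implicits.
Arguments flip2 : clear implicits.

Section Maps.

Variable M : surface_map.

Definition semi_edge (x : M) : bool := flip0 M x == flip2 M x.

Definition proper_map : Prop := forall x : M, ~~ semi_edge x.

Definition vertices : {set {set M}} :=
  orbit 'P <<[set flip1 M; flip2 M]>> @: [set: M].

Definition faces : {set {set M}} :=
  orbit 'P <<[set flip0 M; flip1 M]>> @: [set: M].

Definition full_edges : {set {set M}} :=
  orbit 'P <<[set flip0 M; flip2 M]>> @: [set x | ~~ semi_edge x].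

(* A semi-edge together with its dangling end contributes 1 - 1 = 0. *)
Definition euler_char : int :=
  (#|vertices|%:Z - #|full_edges|%:Z + #|faces|%:Z)%R.

Definition orientable : Prop :=
  exists o : M -> bool,
    forall x, [/\ o (flip0 M x) = ~~ o x, o (flip1 M x) = ~~ o x
                & o (flip2 M x) = ~~ o x].

(* The torus is the closed orientable surface of Euler characteristic 0. *)
Definition on_torus : Prop := orientable /\ euler_char = 0%R.

(* [col x] says whether the edge of the flag [x] is shaded.  The edges of [x]
   and [flip1 x] are consecutive both around a vertex and around a face, and all
   pairs of consecutive edges arise in this way. *)
Definition alternate_edge_colouring (col : M -> bool) : Prop :=
  forall x, [/\ col (flip0 M x) = col x, col (flip2 M x) = col x
              & col (flip1 M x) = ~~ col x].

Definition corner (x : M) : {set M} := [set x; flip1 M x].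

Definition corners : {set {set M}} := corner @: [set: M].

Definition col_aut (col : M -> bool) : {set {perm M}} :=
  [set s in 'C([set flip0 M; flip1 M; flip2 M])
    | [forall x, col (s x) == col x]].

Lemma col_aut_group_set col : group_set (col_aut col).
Proof.
apply/group_setP; split=> [|s t].
  by rewrite inE group1 /=; apply/forallP=> x; rewrite perm1.
rewrite !inE => /andP[Cs /forallP cs] /andP[Ct /forallP ct].
rewrite groupM //=; apply/forallP=> x.
by rewrite permM (eqP (ct _)) (eqP (cs _)).
Qed.

Canonical col_aut_group col := Group (col_aut_group_set col).

Definition edge_biregular (col : M -> bool) : Prop :=
  [/\ alternate_edge_colouring col,
      [transitive col_aut col, on corners | 'P^*]
    & forall C, C \in corners -> 'C_(col_aut col)[C | 'P^*] = 1].

(* The marked corner is given by its shaded flag [x]; its other flag, [flip1 x],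
   lies on the unshaded edge. *)
Definition marked_generators (col : M -> bool) (x : M)
    (r0 r2 rho0 rho2 : {perm M}) : Prop :=
  [/\ col x,
      r0 \in col_aut col /\ 'P^*%act (corner x) r0 = corner (flip0 M x),
      r2 \in col_aut col /\ 'P^*%act (corner x) r2 = corner (flip2 M x),
      rho0 \in col_aut col /\
        'P^*%act (corner x) rho0 = corner (flip0 M (flip1 M x))
    & rho2 \in col_aut col /\
        'P^*%act (corner x) rho2 = corner (flip2 M (flip1 M x))].

End Maps.

(* Unreduced words in n letters; [(i, true)] is the inverse of [(i, false)]. *)
Definition word (n : nat) := seq ('I_n * bool).

Section Words.

Variable n : nat.
Implicit Types u v w : word n.

Definition letter (i : 'I_n) : word n := [:: (i, false)].

Definition word_inv w : word n := rev [seq (p.1, ~~ p.2) | p <- w].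

Definition word_pow w (m : nat) : word n := flatten (nseq m w).

Definition word_eval (gT : finGroupType) (x : n.-tuple gT) w : gT :=
  \prod_(p <- w) (if p.2 then (tnth x p.1)^-1 else tnth x p.1).

(* The words representing an element of the normal closure of [R] in the free
   group on n letters. *)
Inductive normal_closure (R : seq (word n)) : word n -> Prop :=
| NC_nil : normal_closure R [::]
| NC_rel w : w \in R -> normal_closure R w
| NC_mul u v :
    normal_closure R u -> normal_closure R v -> normal_closure R (u ++ v)
| NC_inv u : normal_closure R u -> normal_closure R (word_inv u)
| NC_conj u v :
    normal_closure R u -> normal_closure R (v ++ u ++ word_inv v)
| NC_expand u v i e :
    normal_closure R (u ++ v) ->
    normal_closure R (u ++ [:: (i, e), (i, ~~ e) & v])
| NC_reduce u v i e :
    normal_closure R (u ++ [:: (i, e), (i, ~~ e) & v]) ->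
    normal_closure R (u ++ v).

(* [G = < x | R >]: the letters are interpreted by the tuple [x] of generators.
   The library's [G \isog Grp (...)] forgets the generators, which are part of
   the data of a map, and only tests the presentation against finite groups. *)
Definition presented_by (gT : finGroupType) (G : {set gT}) (x : n.-tuple gT)
    (R : seq (word n)) : Prop :=
  <<[set:: x]>> = G /\
  forall w, word_eval x w = 1 <-> normal_closure R w.

End Words.

Definition l_r0 : word 4 := letter (@Ordinal 4 0 isT).
Definition l_r2 : word 4 := letter (@Ordinal 4 1 isT).
Definition l_rho0 : word 4 := letter (@Ordinal 4 2 isT).
Definition l_rho2 : word 4 := letter (@Ordinal 4 3 isT).

Definition relators44 : seq (word 4) :=
  [:: word_pow l_r0 2; word_pow l_r2 2; word_pow l_rho0 2; word_pow l_rho2 2;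
      word_pow (l_r0 ++ l_r2) 2; word_pow (l_rho0 ++ l_rho2) 2;
      word_pow (l_r0 ++ l_rho0) 2; word_pow (l_r2 ++ l_rho2) 2].

Definition relators_rect (a c : nat) : seq (word 4) :=
  relators44 ++
  [:: word_pow (l_r0 ++ l_rho2) a; word_pow (l_r2 ++ l_rho0) c].

Definition relators_rhomb (b c : nat) : seq (word 4) :=
  relators44 ++
  [:: word_pow (l_r0 ++ l_rho2) (2 * b);
      word_pow (l_r0 ++ l_rho2) b ++ word_pow (l_r2 ++ l_rho0) c].

Definition generators (T : Type) (r0 r2 rho0 rho2 : T) : 4.-tuple T :=
  [tuple r0; r2; rho0; rho2].

(* Twinning and dualising are commuting involutions, so these are all the
   quadruples obtained from (r0, r2, rho0, rho2) by repeatedly applying them: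
   the map itself, its twin, its dual and the twin of its dual. *)
Definition up_to_duality_and_twinness (T : Type) (P : 4.-tuple T -> Prop)
    (r0 r2 rho0 rho2 : T) : Prop :=
  [\/ P (generators r0 r2 rho0 rho2), P (generators rho0 rho2 r0 r2),
      P (generators r2 r0 rho2 rho0) | P (generators rho2 rho0 r2 r0)].

(* Main.v *)
(* Transitivity on corners makes all vertices have the same number 2k of flags
   and all faces the same number 2l; the colouring makes k and l even, so Euler
   characteristic 0, i.e. 1/k + 1/l = 1/2, forces k = l = 4.  Hence H is a
   quotient of the group presented by the first eight relators, which is the
   product of the infinite dihedral groups <r0, rho2> and <r2, rho0>.  The
   kernel contains no orientation-reversing element, and no rotation of order 2,
   since such a rotation is conjugate to the product of one of r0, rho2 with one
   of r2, rho0.  So the kernel is a lattice in <u> x <v>, where u = r0 rho2 and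
   v = r2 rho0, and it is invariant under inverting either factor.  If u and v
   have orders m and n in H, the kernel is therefore either generated by u^m and
   v^n, or by these and u^(m/2) v^(n/2). *)

Require Import Defs.
From Stdlib Require Import Setoid.
From Stdlib Require Morphisms.
From mathcomp Require Import all_boot all_order all_algebra all_fingroup.
From mathcomp Require Import cyclic zify.

Set Implicit Arguments.
Unset Strict Implicit.
Unset Printing Implicit Defensive.

Import Morphisms.ProperNotations.

(** * Words modulo the normal closure of a set of relators *)

Section WordEquivalence.

Variables (n : nat) (R : seq (word n)).
Implicit Types u v w : word n.

(** Equality in the group presented by [R], so that calculations in that group become setoid
    rewriting on words. *)
Definition word_equiv u v := normal_closure R (u ++ word_inv v).

Local Notation "u ~ v" := (word_equiv u v) (at level 70).

Lemma word_inv_cat u v : word_inv (u ++ v) = word_inv v ++ word_inv u.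
Proof. by rewrite /word_inv map_cat rev_cat. Qed.

Lemma word_invK : involutive (@word_inv n).
Proof.
move=> w; rewrite /word_inv map_rev revK -map_comp -[RHS]map_id.
by apply: eq_map => -[i e] /=; rewrite negbK.
Qed.

(** The closure rules cancel one letter at a time, so the tail of [w] goes first, which brings the
    leading letter next to its inverse. *)
Lemma normal_closure_cancel w u v :
  normal_closure R (u ++ w ++ word_inv w ++ v) <-> normal_closure R (u ++ v).
Proof.
elim: w u v => [|[i e] w IHw] u v //.
have -> : u ++ ((i, e) :: w) ++ word_inv ((i, e) :: w) ++ v
    = (u ++ [:: (i, e)]) ++ w ++ word_inv w ++ ((i, ~~ e) :: v).
  by rewrite -cat1s word_inv_cat -!catA.
rewrite IHw -catA /=; split; [exact: NC_reduce | exact: NC_expand].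
Qed.

Lemma normal_closureE w : normal_closure R w <-> w ~ [::].
Proof. by rewrite /word_equiv cats0. Qed.

Lemma relator_equiv w : w \in R -> w ~ [::].
Proof. by move=> wR; rewrite /word_equiv cats0; apply: NC_rel. Qed.

Lemma word_equiv_refl u : u ~ u.
Proof.
rewrite /word_equiv -[u ++ _]cats0 -catA.
by apply/(normal_closure_cancel u [::]); apply: NC_nil.
Qed.

Lemma word_equiv_sym u v : u ~ v -> v ~ u.
Proof. by move=> /NC_inv; rewrite word_inv_cat word_invK. Qed.

Lemma word_equiv_trans u v w : u ~ v -> v ~ w -> u ~ w.
Proof.
move=> uv /(NC_mul uv); rewrite -catA -{2}[v]word_invK.
by move/normal_closure_cancel.
Qed.

(** Normality enters here: u (v v'^-1) u^-1 followed by u u'^-1 reduces to u v (u' v')^-1. *)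
Lemma word_equiv_cat u u' v v' : u ~ u' -> v ~ v' -> u ++ v ~ u' ++ v'.
Proof.
move=> uu' vv'; have := NC_mul (NC_conj u vv') uu'.
have -> : (u ++ (v ++ word_inv v') ++ word_inv u) ++ u ++ word_inv u'
    = (u ++ v ++ word_inv v') ++ word_inv u ++ word_inv (word_inv u)
      ++ word_inv u'.
  by rewrite word_invK -!catA.
by move/normal_closure_cancel; rewrite /word_equiv word_inv_cat -!catA.
Qed.

#[local] Instance word_equiv_equivalence : Equivalence word_equiv.
Proof.
split; [exact: word_equiv_refl | exact: word_equiv_sym |].
exact: word_equiv_trans.
Qed.

#[local] Instance cat_word_equiv :
  Morphisms.Proper (word_equiv ==> word_equiv ==> word_equiv)
    (@cat ('I_n * bool)).
Proof. by move=> u u1 uu v v1; apply: word_equiv_cat. Qed.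

Lemma word_powD w i j : word_pow w (i + j) = word_pow w i ++ word_pow w j.
Proof. by rewrite /word_pow nseqD flatten_cat. Qed.

Lemma word_powS w i : word_pow w i.+1 = w ++ word_pow w i.
Proof. by []. Qed.

Lemma word_powSr w i : word_pow w i.+1 = word_pow w i ++ w.
Proof. by rewrite -addn1 word_powD /word_pow /= cats0. Qed.

Lemma word_pow2 w : word_pow w 2 = w ++ w.
Proof. by rewrite /word_pow /= cats0. Qed.

Lemma size_word_pow w i : size (word_pow w i) = i * size w.
Proof. by rewrite /word_pow size_flatten /shape map_nseq sumn_nseq mulnC. Qed.

Lemma word_pow_mul_equiv w m k : word_pow w m ~ [::] ->
  word_pow w (k * m) ~ [::].
Proof.
move=> wm; elim: k => [|k IHk]; first by rewrite mul0n; reflexivity.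
by rewrite mulSn word_powD wm IHk; reflexivity.
Qed.

(** Put the relator uvuv in front of vu; then vv and uu cancel and leave uv. *)
Lemma word_comm_of_involutions u v : u ++ u ~ [::] -> v ++ v ~ [::] ->
  word_pow (u ++ v) 2 ~ [::] -> u ++ v ~ v ++ u.
Proof.
rewrite word_pow2 => uu vv uvuv; symmetry.
transitivity (u ++ v ++ u ++ (v ++ v) ++ u).
  by rewrite -[v ++ u]cat0s -{1}uvuv -!catA; reflexivity.
rewrite vv cat0s.
transitivity (u ++ v ++ (u ++ u)); first by reflexivity.
by rewrite uu cats0; reflexivity.
Qed.

Lemma word_comm_cat u v w :
  u ++ w ~ w ++ u -> v ++ w ~ w ++ v -> (u ++ v) ++ w ~ w ++ (u ++ v).
Proof. by move=> uw vw; rewrite -catA vw !catA uw; reflexivity. Qed.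

Lemma word_comm_pow u w i :
  u ++ w ~ w ++ u -> word_pow u i ++ w ~ w ++ word_pow u i.
Proof.
move=> uw; elim: i => [|i IHi]; first by rewrite cats0; reflexivity.
by rewrite word_powS; apply: word_comm_cat.
Qed.

(** * Normal forms in dihedral groups *)

Section Dihedral.

Variables (s t : word n) (m : nat).
Hypotheses (ss : s ++ s ~ [::]) (tt : t ++ t ~ [::]).
Hypotheses (m_gt0 : 0 < m) (stm : word_pow (s ++ t) m ~ [::]).

(** A rotation, or a reflection if [e] holds. Natural exponents suffice because st has finite
    order. *)
Definition dihedral_word i (e : bool) :=
  word_pow (s ++ t) i ++ (if e then s else [::]).

Lemma dihedral_word_rcons i e w : w \in [:: s; t] ->
  exists i' e', dihedral_word i e ++ w ~ dihedral_word i' e'.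
Proof.
rewrite !inE /dihedral_word => /orP[]/eqP->.
  exists i, (~~ e); case: e; last by rewrite -catA; reflexivity.
  by rewrite -catA ss; reflexivity.
case: e.
  by exists i.+1, false; rewrite word_powSr cats0 -catA; reflexivity.
(* Here (st)^i t equals (st)^(i-1) s; adding m to the exponent keeps it natural when i = 0. *)
exists (i + m.-1), true; rewrite cats0.
symmetry; transitivity ((word_pow (s ++ t) (i + m.-1) ++ s) ++ t ++ t).
  by rewrite tt cats0; reflexivity.
rewrite catA -[(_ ++ s) ++ t]catA -word_powSr -addnS prednK //.
by rewrite word_powD stm cats0; reflexivity.
Qed.

Lemma dihedral_word_comm i e w : s ++ w ~ w ++ s -> t ++ w ~ w ++ t ->
  dihedral_word i e ++ w ~ w ++ dihedral_word i e.
Proof.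
move=> sw tw; apply: word_comm_cat; first exact/word_comm_pow/word_comm_cat.
by case: e => //; rewrite cats0; reflexivity.
Qed.

(** Length parity separates reflections from rotations, which lets orientability act on normal
    forms. *)
Lemma odd_size_dihedral_word i e : size s = 1 -> size t = 1 ->
  odd (size (dihedral_word i e)) = e.
Proof.
move=> s1 t1; rewrite size_cat size_word_pow size_cat s1 t1 oddD oddM andbF.
by case: e; rewrite ?s1.
Qed.

End Dihedral.

Lemma letter_inv_equiv i e : letter i ++ letter i ~ [::] ->
  [:: (i, e)] ~ letter i.
Proof.
move=> ii; case: e; last by reflexivity.
by apply/word_equiv_sym; rewrite /word_equiv.
Qed.

(** * Evaluation of words in a finite group *)

Section Eval.

Variables (gT : finGroupType) (x : n.-tuple gT).
Local Open Scope group_scope.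

Lemma word_eval_cat u v : word_eval x (u ++ v) = word_eval x u * word_eval x v.
Proof. by rewrite /word_eval big_cat. Qed.

Lemma word_eval_inv u : word_eval x (word_inv u) = (word_eval x u)^-1.
Proof.
elim: u => [|[i e] u IHu]; first by rewrite /word_eval !big_nil invg1.
rewrite -cat1s word_inv_cat !word_eval_cat IHu invMg; congr (_ * _).
by rewrite /word_eval !big_seq1 /=; case: e; rewrite ?invgK.
Qed.

Lemma word_eval_pow u i : word_eval x (word_pow u i) = word_eval x u ^+ i.
Proof.
elim: i => [|i IHi]; first by rewrite /word_eval big_nil.
by rewrite word_powS word_eval_cat IHi expgS.
Qed.

Lemma word_eval_letter i : word_eval x (letter i) = tnth x i.
Proof. by rewrite /word_eval big_seq1. Qed.

(** The easy half of a presentation, by induction on the derivation. *)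
Lemma word_eval_normal_closure :
  (forall w, w \in R -> word_eval x w = 1) ->
  forall w, normal_closure R w -> word_eval x w = 1.
Proof.
have cancel u v i e :
    word_eval x (u ++ [:: (i, e), (i, ~~ e) & v]) = word_eval x (u ++ v).
  rewrite -[_ :: _ :: v]/([:: (i, e)] ++ word_inv [:: (i, e)] ++ v).
  by rewrite !word_eval_cat word_eval_inv mulKVg.
move=> R1 w.
elim=> {w} [|w /R1//|u v _ u1 _ v1|u _ u1|u v _ u1|u v i e _|u v i e _].
- by rewrite /word_eval big_nil.
- by rewrite word_eval_cat u1 v1 mulg1.
- by rewrite word_eval_inv u1 invg1.
- by rewrite !word_eval_cat word_eval_inv u1 mul1g mulgV.
- by rewrite cancel.
- by rewrite cancel.
Qed.

Lemma word_eval_equiv u v :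
  (forall w, w \in R -> word_eval x w = 1) ->
  u ~ v -> word_eval x u = word_eval x v.
Proof.
move=> R1 /(word_eval_normal_closure R1).
by rewrite word_eval_cat word_eval_inv => /eqP; rewrite -eq_mulgV1 => /eqP.
Qed.

End Eval.

End WordEquivalence.

(** * Quotients of the product of two infinite dihedral groups *)

#[local] Existing Instances word_equiv_equivalence cat_word_equiv.

Definition translation_word i j : word 4 :=
  word_pow (l_r0 ++ l_rho2) i ++ word_pow (l_r2 ++ l_rho0) j.

(** * Normal forms for two commuting dihedral factors *)

Section NormalForm.

Variables (R : seq (word 4)) (m n : nat).
Hypothesis R44 : {subset relators44 <= R}.
Hypotheses (m_gt0 : 0 < m) (n_gt0 : 0 < n).
Local Notation "u ~ v" := (word_equiv R u v) (at level 70).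
Hypothesis um : word_pow (l_r0 ++ l_rho2) m ~ [::].
Hypothesis vn : word_pow (l_r2 ++ l_rho0) n ~ [::].

Lemma relator44_equiv w : w \in relators44 -> w ~ [::].
Proof. by move=> /R44; apply: relator_equiv. Qed.

Lemma letters44_sq :
  [/\ l_r0 ++ l_r0 ~ [::], l_r2 ++ l_r2 ~ [::], l_rho0 ++ l_rho0 ~ [::]
    & l_rho2 ++ l_rho2 ~ [::]].
Proof. by split; rewrite -word_pow2; apply: relator44_equiv. Qed.

(** These are all pairs with one letter from [l_r0], [l_rho2] and one from [l_r2], [l_rho0]: the two
    dihedral factors commute. *)
Lemma letters44_comm :
  [/\ l_r0 ++ l_r2 ~ l_r2 ++ l_r0, l_rho0 ++ l_rho2 ~ l_rho2 ++ l_rho0,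
      l_r0 ++ l_rho0 ~ l_rho0 ++ l_r0 & l_r2 ++ l_rho2 ~ l_rho2 ++ l_r2].
Proof.
have [? ? ? ?] := letters44_sq.
by split; apply: word_comm_of_involutions => //; apply: relator44_equiv;
  rewrite !inE eqxx ?orbT.
Qed.

(** Induction on the last letter: one from the first factor is moved left across the second normal
    form before being absorbed. *)
Lemma word44_normal_form w : exists i e j f,
  w ~ dihedral_word l_r0 l_rho2 i e ++ dihedral_word l_r2 l_rho0 j f.
Proof.
have [sq0 sq2 sqr0 sqr2] := letters44_sq.
have [c02 cr02 c00 c22] := letters44_comm.
elim/last_ind: w => [|w [k s] [i [e [j [f IHw]]]]].
  by exists 0, false, 0, false; reflexivity.
have [kt|kt] : letter k \in [:: l_r0; l_rho2] \/ letter k \in [:: l_r2; l_rho0].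
- by case: k => -[|[|[|[|//]]]] ?; [left|right|right|left];
    rewrite !inE; apply/orP; [left|left|right|right]; apply/eqP;
    congr [:: (_, _)]; apply: val_inj.
- have ksq : letter k ++ letter k ~ [::].
    by move: kt; rewrite !inE => /orP[]/eqP->.
  have [i' [e' E]] := dihedral_word_rcons sq0 sqr2 m_gt0 um i e kt.
  exists i', e', j, f.
  rewrite -cats1 (letter_inv_equiv s ksq) IHw -catA.
  rewrite (@dihedral_word_comm _ _ l_r2 l_rho0 j f (letter k)).
  - by rewrite catA E; reflexivity.
  - by move: kt; rewrite !inE => /orP[]/eqP->; [symmetry|].
  - by move: kt; rewrite !inE => /orP[]/eqP->; [symmetry|].
have ksq : letter k ++ letter k ~ [::].
  by move: kt; rewrite !inE => /orP[]/eqP->.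
have [j' [f' E]] := dihedral_word_rcons sq2 sqr0 n_gt0 vn j f kt.
exists i, e, j', f'.
by rewrite -cats1 (letter_inv_equiv s ksq) IHw -catA E; reflexivity.
Qed.

Lemma translation_wordD i j k l :
  translation_word (i + k * m) (j + l * n) ~ translation_word i j.
Proof.
rewrite /translation_word !word_powD.
rewrite (word_pow_mul_equiv k um) (word_pow_mul_equiv l vn) !cats0.
by reflexivity.
Qed.

End NormalForm.

(** In 2i = ka an even k would give a | i. So k is odd, hence a is even, and i = a/2 + ((k-1)/2)
    a. *)
Lemma half_of_double_multiple a i : a %| 2 * i -> ~~ (a %| i) ->
  exists2 q, ~~ odd a & i = a./2 + q * a.
Proof.
case/dvdnP=> k ik nai.
have ok : odd k.
  apply: contraNT nai => ek; apply/dvdnP; exists k./2.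
  by have := even_halfK ek; nia.
have ea : ~~ odd a.
  by have := congr1 odd ik; rewrite oddM oddM ok /= => <-.
exists k./2 => //.
have := odd_double_half k; have := even_halfK ea; rewrite ok; nia.
Qed.

(** * Trivial translations and the two presentations *)

Section Quotient.

Local Open Scope group_scope.

Lemma sq1_invg (gT : finGroupType) (x : gT) : x ^+ 2 = 1 -> x^-1 = x.
Proof. by move=> xx; apply/eqP; rewrite eq_invg_mul -expg2 xx. Qed.

Lemma comm_of_involutions (gT : finGroupType) (x y : gT) :
  x ^+ 2 = 1 -> y ^+ 2 = 1 -> (x * y) ^+ 2 = 1 -> commute x y.
Proof.
move=> /sq1_invg xx /sq1_invg yy /sq1_invg xy.
by rewrite /commute -xy invMg xx yy.
Qed.

Variables (gT : finGroupType) (r0 r2 rho0 rho2 : gT).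
Let g := generators r0 r2 rho0 rho2.

Hypothesis rel44 : forall w, w \in relators44 -> word_eval g w = 1.
(** Orientability: every generator will be orientation-reversing. *)
Hypothesis even44 : forall w, word_eval g w = 1 -> ~~ odd (size w).
(** The first two say that there are no semi-edges; the other two come from face length and valency
    4. *)
Hypotheses (n02 : r0 != r2) (nr02 : rho0 != rho2).
Hypotheses (n00 : r0 != rho0) (n22 : r2 != rho2).

Let u := r0 * rho2.
Let v := r2 * rho0.

Lemma eval_l_r0 : word_eval g l_r0 = r0.
Proof. exact: word_eval_letter. Qed.
Lemma eval_l_r2 : word_eval g l_r2 = r2.
Proof. exact: word_eval_letter. Qed.
Lemma eval_l_rho0 : word_eval g l_rho0 = rho0.
Proof. exact: word_eval_letter. Qed.
Lemma eval_l_rho2 : word_eval g l_rho2 = rho2.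
Proof. exact: word_eval_letter. Qed.

Let evalE := (word_eval_cat, word_eval_pow,
              eval_l_r0, eval_l_r2, eval_l_rho0, eval_l_rho2).

Lemma generators44_sq :
  [/\ r0 ^+ 2 = 1, r2 ^+ 2 = 1, rho0 ^+ 2 = 1 & rho2 ^+ 2 = 1].
Proof.
split; [have := rel44 (w := word_pow l_r0 2)
  | have := rel44 (w := word_pow l_r2 2)
  | have := rel44 (w := word_pow l_rho0 2)
  | have := rel44 (w := word_pow l_rho2 2)];
  by rewrite !evalE; apply.
Qed.

Lemma generators44_comm :
  [/\ commute r0 r2, commute rho0 rho2, commute r0 rho0 & commute r2 rho2].
Proof.
have [? ? ? ?] := generators44_sq.
split; apply: comm_of_involutions => //;
  [have := rel44 (w := word_pow (l_r0 ++ l_r2) 2)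
  | have := rel44 (w := word_pow (l_rho0 ++ l_rho2) 2)
  | have := rel44 (w := word_pow (l_r0 ++ l_rho0) 2)
  | have := rel44 (w := word_pow (l_r2 ++ l_rho2) 2)];
  by rewrite !evalE; apply.
Qed.

(* Conjugate by [r0], which inverts [u] and centralises [v]. *)
Lemma translation_eq1 i j :
  u ^+ i * v ^+ j = 1 -> u ^+ (2 * i) = 1 /\ v ^+ (2 * j) = 1.
Proof.
have [s0 s2 sr0 sr2] := generators44_sq.
have [c02 cr02 c00 c22] := generators44_comm.
move=> uv1; have := congr1 (conjg^~ r0) uv1.
rewrite conjMg !conjXg conj1g.
have -> : u ^ r0 = u^-1.
  rewrite conjgE /u invMg !mulgA mulVg mul1g.
  by rewrite !sq1_invg.
have -> : v ^ r0 = v.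
  by apply/conjg_fixP/commgP; apply: commute_sym; apply: commuteM.
move=> uv1'.
have ei : v ^+ j = u ^+ i.
  by apply/eqP; rewrite -(inj_eq (mulgI (u^-1 ^+ i))) uv1' expgVn mulVg.
split; first by rewrite mulnC expgM expgS expg1 -{2}ei.
by rewrite mulnC expgM expgS expg1 {1}ei.
Qed.

(** Conjugation by ts raises the exponent of st by two, so the induction carries two consecutive
    exponents, starting from s and sts. *)
Lemma reflection_conj (s t : gT) i : s ^+ 2 = 1 -> t ^+ 2 = 1 ->
  exists z h, [/\ z \in [:: s; t], h \in <<[set s; t]>>
                & (s * t) ^+ i * s = z ^ h].
Proof.
move=> ss tt; have sin : s \in <<[set s; t]>> by rewrite mem_gen ?set21.
have tin : t \in <<[set s; t]>> by rewrite mem_gen ?set22.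
suff [] : (exists z h, [/\ z \in [:: s; t], h \in <<[set s; t]>>
             & (s * t) ^+ i * s = z ^ h])
    /\ (exists z h, [/\ z \in [:: s; t], h \in <<[set s; t]>>
             & (s * t) ^+ i.+1 * s = z ^ h]) by [].
elim: i => [|i [[z [h [zin hin E]]] IHi]]; split => //.
- by exists s, 1; rewrite expg0 mul1g conjg1 mem_head group1.
- exists t, s; rewrite expg1 conjgE sq1_invg // mulgA sin.
  by rewrite !inE eqxx orbT.
exists z, (h * (t * s)); rewrite zin !groupM //; split=> //.
rewrite conjgM -E conjgE invMg !sq1_invg // expgSr expgS.
by rewrite !mulgA.
Qed.

(** A half-turn is a reflection of one factor times a reflection of the other. It is conjugate to a
    product of two generators, one from each factor, and these differ by hypothesis. *)
Lemma rotation_neq1 i j : u ^+ i * r0 * (v ^+ j * r2) != 1.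
Proof.
have [s0 s2 sr0 sr2] := generators44_sq.
have [c02 cr02 c00 c22] := generators44_comm.
have [z [h [zin hin ->]]] := reflection_conj i s0 sr2.
have [z' [h' [zin' hin' ->]]] := reflection_conj j s2 sr0.
have cent : <<[set r2; rho0]>> \subset 'C(<<[set r0; rho2]>>).
  rewrite gen_subG centsC gen_subG; apply/centsP=> y + y'.
  rewrite !inE => /orP[]/eqP-> /orP[]/eqP-> //; exact: commute_sym.
have zg : z \in <<[set r0; rho2]>>.
  by apply: mem_gen; move: zin; rewrite !inE.
have zg' : z' \in <<[set r2; rho0]>>.
  by apply: mem_gen; move: zin'; rewrite !inE.
have cc a b : a \in <<[set r0; rho2]>> -> b \in <<[set r2; rho0]>> -> a ^ b = a.
  move=> ain bin; apply/conjg_fixP/commgP; apply: commute_sym.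
  by apply: (centP (subsetP cent _ bin)).
(* Since the factors commute, each conjugator affects only its own factor, so [h * h'] conjugates
   both at once. *)
have -> : z ^ h * z' ^ h' = (z * z') ^ (h * h').
  have cc' : z' ^ h = z'.
    by apply/conjg_fixP/commgP; apply: (centP (subsetP cent _ zg')).
  by rewrite conjMg !conjgM cc' (cc (z ^ h)) // groupJ.
rewrite conjg_eq1 -eq_invg_mul sq1_invg; last first.
  by move: zin; rewrite !inE => /orP[]/eqP->.
by move: zin zin'; rewrite !inE => /orP[]/eqP-> /orP[]/eqP-> //; rewrite eq_sym.
Qed.

(** As the product is 1, u^i = 1 exactly when v^j = 1. If both fail, [translation_eq1] makes both
    exponents odd multiples of half the orders. *)
Lemma translation_eq1_cases i j : u ^+ i * v ^+ j = 1 ->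
  (exists q k, i = (q * #[u])%N /\ j = (k * #[v])%N) \/
  [/\ ~~ odd #[u], ~~ odd #[v], u ^+ #[u]./2 * v ^+ #[v]./2 = 1
    & exists q k, i = (#[u]./2 + q * #[u])%N /\ j = (#[v]./2 + k * #[v])%N].
Proof.
move=> uv1; have [/eqP u2 /eqP v2] := translation_eq1 uv1.
rewrite -order_dvdn in u2; rewrite -order_dvdn in v2.
have iff_ij : (#[u] %| i) = (#[v] %| j).
  rewrite !order_dvdn; apply/eqP/eqP => E; move: uv1.
    by rewrite E mul1g.
  by rewrite E mulg1.
case: (boolP (#[u] %| i)) => ui.
  left; have vj := ui; rewrite iff_ij in vj.
  by case/dvdnP: ui => q ->; case/dvdnP: vj => k ->; exists q, k.
have [q eu iE] := half_of_double_multiple u2 ui.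
rewrite iff_ij in ui; have [k ev jE] := half_of_double_multiple v2 ui.
right; split=> //; last by exists q, k.
rewrite -[RHS]uv1 iE jE !expgD ![(_ * #[_])%N]mulnC !expgM !expg_order !expg1n.
by rewrite !mulg1.
Qed.

(** The lattice of trivial translations is rectangular unless it contains the centre of its
    rectangle, the point with both orders halved; this decides between the presentations. *)
Lemma presentation44 :
  (exists a c : nat, [/\ 0 < a, 0 < c &
     forall w, word_eval g w = 1 <-> normal_closure (relators_rect a c) w]) \/
  (exists b c : nat, [/\ 0 < b, 0 < c &
     forall w, word_eval g w = 1 <-> normal_closure (relators_rhomb b c) w]).
Proof.
have [s0 s2 sr0 sr2] := generators44_sq.
(* Only translations have to be derived from [R]: a word with value 1 has even length, so its normal
   form has no reflection or one in each factor, and [rotation_neq1] rules out the latter. *)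
have NF (R : seq (word 4)) m n : {subset relators44 <= R} -> 0 < m -> 0 < n ->
    word_equiv R (word_pow (l_r0 ++ l_rho2) m) [::] ->
    word_equiv R (word_pow (l_r2 ++ l_rho0) n) [::] ->
    (forall w, w \in R -> word_eval g w = 1) ->
    (forall i j, u ^+ i * v ^+ j = 1 ->
       word_equiv R (translation_word i j) [::]) ->
    forall w, word_eval g w = 1 <-> normal_closure R w.
  move=> R44 m0 n0 um vn R1 RT w.
  split; last exact: word_eval_normal_closure.
  have [i [e [j [f E]]]] := word44_normal_form R44 m0 n0 um vn w.
  rewrite (word_eval_equiv R1 E) => w1.
  have := even44 w1; rewrite size_cat oddD !odd_size_dihedral_word //.
  case: e f E w1 => -[] // E.
    by rewrite !evalE => /eqP; rewrite (negPf (rotation_neq1 _ _)).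
  rewrite /dihedral_word !cats0 !evalE => /RT ij _.
  apply/(normal_closureE R w); rewrite E /dihedral_word !cats0; exact: ij.
have u0 : 0 < #[u] by exact: order_gt0.
have v0 : 0 < #[v] by exact: order_gt0.
have [/and3P[eu ev /eqP uv1]|nR] := boolP [&& ~~ odd #[u], ~~ odd #[v]
                                    & u ^+ #[u]./2 * v ^+ #[v]./2 == 1].
  right; exists #[u]./2, #[v]./2.
  have uE : (2 * #[u]./2 = #[u])%N by rewrite mul2n even_halfK.
  have vE : (2 * #[v]./2 = #[v])%N by rewrite mul2n even_halfK.
  split; [by lia | by lia |].
  set R := relators_rhomb _ _.
  have R44 : {subset relators44 <= R} by move=> w; rewrite mem_cat => ->.
  have ub : word_equiv R (word_pow (l_r0 ++ l_rho2) #[u]) [::].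
    apply: relator_equiv.
    by rewrite mem_cat !inE uE eqxx orbT.
  have uvb : word_equiv R (translation_word #[u]./2 #[v]./2) [::].
    by apply: relator_equiv; rewrite mem_cat !inE eqxx !orbT.
  (* The power v^(2c) is not among the relators; it follows by squaring u^b v^c and cancelling
     u^(2b). *)
  have vb : word_equiv R (word_pow (l_r2 ++ l_rho0) #[v]) [::].
    have [c02 cr02 c00 c22] := letters44_comm R44.
    have uvC : word_equiv R
        (word_pow (l_r0 ++ l_rho2) #[u]./2 ++ word_pow (l_r2 ++ l_rho0) #[v]./2)
        (word_pow (l_r2 ++ l_rho0) #[v]./2
         ++ word_pow (l_r0 ++ l_rho2) #[u]./2).
      apply: word_comm_pow; symmetry; apply: word_comm_pow.
      by apply: word_comm_cat; symmetry; apply: word_comm_cat=> //; symmetry.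
    transitivity (translation_word #[u]./2 #[v]./2
                  ++ translation_word #[u]./2 #[v]./2); last first.
      by rewrite uvb; reflexivity.
    rewrite {1}/translation_word uvC -catA /translation_word.
    rewrite [word_pow (l_r0 ++ l_rho2) _ ++ _ ++ _]catA -word_powD addnn.
    rewrite -mul2n uE ub cat0s -word_powD addnn -mul2n vE.
    by reflexivity.
  apply: (NF R #[u] #[v]) => //.
  - move=> w; rewrite mem_cat => /orP[/rel44//|].
    rewrite !inE => /orP[]/eqP->; last by rewrite !evalE.
    by rewrite !evalE uE expg_order.
  move=> i j ij.
  have [[q [k [-> ->]]]|[_ _ _ [q [k [-> ->]]]]] := translation_eq1_cases ij.
    (* [translation_word 0 0] computes to the empty word. *)
    by apply: (translation_wordD ub vb 0 0).
  by rewrite (translation_wordD ub vb).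
left; exists #[u], #[v]; split=> //.
set R := relators_rect _ _.
have R44 : {subset relators44 <= R} by move=> w; rewrite mem_cat => ->.
have ub : word_equiv R (word_pow (l_r0 ++ l_rho2) #[u]) [::].
  by apply: relator_equiv; rewrite mem_cat !inE eqxx !orbT.
have vb : word_equiv R (word_pow (l_r2 ++ l_rho0) #[v]) [::].
  by apply: relator_equiv; rewrite mem_cat !inE eqxx !orbT.
apply: (NF R #[u] #[v]) => //.
- move=> w; rewrite mem_cat => /orP[/rel44//|].
  by rewrite !inE => /orP[]/eqP->; rewrite !evalE expg_order.
move=> i j ij.
have [[q [k [-> ->]]]|[? ? ? _]] := translation_eq1_cases ij; last first.
  by case/and3P: nR; split=> //; apply/eqP.
exact: (translation_wordD ub vb 0 0).
Qed.

End Quotient.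

(** * Orbits of permutation groups *)

Section PermOrbits.

Local Open Scope group_scope.
Variable T : finType.
Implicit Types (f g s h : {perm T}) (A : {set {perm T}}) (S : {set T}).

Lemma orbit_gen_sub A S y :
  y \in S -> (forall a z, a \in A -> z \in S -> a z \in S) ->
  orbit 'P <<A>> y \subset S.
Proof.
move=> yS AS; rewrite acts_sub_orbit //.
rewrite gen_subG; apply/subsetP=> a aA; rewrite !inE /=.
by apply/subsetP=> z zS; rewrite inE; apply: AS.
Qed.

(** A permutation commuting with [A] maps orbits bijectively onto orbits. *)
Lemma card_orbit_cent A h y :
  h \in 'C(A) -> #|orbit 'P <<A>> (h y)| = #|orbit 'P <<A>> y|.
Proof.
rewrite -cent_gen => hA.
have -> : orbit 'P <<A>> (h y) = h @: orbit 'P <<A>> y.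
  rewrite /orbit -imset_comp; apply: eq_in_imset => k kA /=.
  by rewrite /aperm -!permM (centP hA).
by rewrite card_imset //; apply: perm_inj.
Qed.

(** The values of [o] alternate along the cycle. *)
Lemma odd_porbit (o : T -> bool) s y :
  (forall z, o (s z) = ~~ o z) -> ~~ odd #|porbit s y|.
Proof.
move=> os; have iterE n : o (iter n s y) = odd n (+) o y.
  by elim: n => //= n IHn; rewrite os IHn addNb.
have := congr1 o (iter_porbit s y); rewrite iterE.
by case: odd => //=; case: (o y).
Qed.

Lemma card_porbit2 s y : s y != y -> s (s y) = y -> #|porbit s y| = 2.
Proof.
move=> sy ssy; have := uniq_traject_porbit s y; have := iter_porbit s y.
case: #|_| (card_porbit_neq0 s y) => [//|[|[|n]]] _ //=.
  by move=> E; rewrite E eqxx in sy.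
by rewrite ssy !inE eqxx !orbT.
Qed.

(** The orbit is the cycle P of [f * g] together with f(P). These are disjoint because [o] is
    constant on P and changed by [f]. *)
Lemma card_orbit_involutions (o : T -> bool) f g y :
  involutive f -> involutive g ->
  (forall z, o (f z) = ~~ o z) -> (forall z, o (g z) = ~~ o z) ->
  #|orbit 'P <<[set f; g]>> y| = (2 * #|porbit (f * g) y|)%N.
Proof.
move=> ff gg of_ og; pose P := porbit (f * g) y.
have oP z : z \in P -> o z = o y.
  case/porbitP=> i ->; elim: i => [|i IHi]; first by rewrite expg0 perm1.
  by rewrite expgSr !permM og of_ negbK.
have PS z : z \in P -> g (f z) \in P.
  by case/porbitP=> i ->; apply/porbitP; exists i.+1; rewrite expgSr !permM.
(* This is closure under the inverse of [f * g]. *)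
have PV z : z \in P -> f (g z) \in P.
  have zt : z \in porbit (f * g) (f (g z)).
    by have := mem_porbit (f * g) 1 (f (g z)); rewrite expg1 permM ff gg.
  rewrite /P -!eq_porbit_mem => /eqP <-.
  by rewrite eq_sym eq_porbit_mem.
have -> : orbit 'P <<[set f; g]>> y = P :|: f @: P.
  apply/eqP; rewrite eqEsubset; apply/andP; split.
    apply: orbit_gen_sub; first by rewrite inE porbit_id.
    move=> a z; rewrite !inE => /orP[]/eqP-> {a} /orP[zP|/imsetP[t tP ->{z}]].
    - by rewrite imset_f ?orbT.
    - by rewrite ff tP.
    - by rewrite -[g z]ff imset_f ?PV ?orbT.
    - by rewrite PS.
  have fin : f \in <<[set f; g]>> by rewrite mem_gen ?set21.
  have gin : g \in <<[set f; g]>> by rewrite mem_gen ?set22.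
  rewrite subUset; apply/andP; split; apply/subsetP=> z.
    by case/porbitP=> i ->; apply: mem_orbit; rewrite groupX ?groupM.
  case/imsetP=> t /porbitP[i ->] ->; rewrite -permM.
  by apply: mem_orbit; rewrite groupM ?groupX ?groupM.
rewrite cardsU (_ : P :&: _ = set0) ?cards0; last first.
  apply/setP=> z; rewrite !inE; apply/negP=> /andP[/oP zP /imsetP[t /oP tP zt]].
  by move: zP; rewrite zt of_ tP; case: (o y).
by rewrite subn0 card_imset ?mul2n ?addnn //; apply: perm_inj.
Qed.

Lemma card_orbits A n :
  (forall y, #|orbit 'P <<A>> y| = n) ->
  (#|T| = #|orbit 'P <<A>> @: [set: T]| * n)%N.
Proof.
move=> An; rewrite -cardsT; apply: card_uniform_partition.
  by move=> B /imsetP[y _ ->].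
by apply: orbit_partition; apply/subsetP=> a _; rewrite !inE /= preimsetT.
Qed.

End PermOrbits.

(** * Edge-biregular maps on the torus *)

Section ToroidalMap.

Local Open Scope group_scope.

Variables (M : surface_map) (col : M -> bool).
Local Notation f0 := (flip0 M).
Local Notation f1 := (flip1 M).
Local Notation f2 := (flip2 M).
Implicit Types (y z : M) (h k : {perm M}) (S : {set M}).

(** Connectedness, in the form of an induction principle on flags. *)
Lemma flip_closed_full S y : y \in S ->
  (forall z, z \in S -> [/\ f0 z \in S, f1 z \in S & f2 z \in S]) ->
  forall z, z \in S.
Proof.
move=> yS fS z; have orbE := atransP (flip_connected M) y (in_setT y).
have /subsetP : orbit 'P <<[set f0; f1; f2]>> y \subset S.
  apply: orbit_gen_sub => // a t; rewrite !inE -orbA.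
  by case/or3P=> /eqP-> /fS[].
by apply; rewrite orbE.
Qed.

Lemma col_aut_flip h : h \in col_aut col ->
  [/\ forall z, h (f0 z) = f0 (h z), forall z, h (f1 z) = f1 (h z),
      forall z, h (f2 z) = f2 (h z) & forall z, col (h z) = col z].
Proof.
rewrite inE => /andP[/centP hf /forallP hc]; split=> z; last exact/eqP.
all: by rewrite -!permM hf // !inE eqxx ?orbT.
Qed.

(** The flags on which two automorphisms agree are closed under the flips. *)
Lemma col_aut_eq h k y :
  h \in col_aut col -> k \in col_aut col -> h y = k y -> h = k.
Proof.
move=> /col_aut_flip[h0 h1 h2 _] /col_aut_flip[k0 k1 k2 _] hy.
have hk := @flip_closed_full [set z | h z == k z] y.
apply/permP=> z; apply/eqP; have := hk _ _ z; rewrite !inE; apply.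
  by rewrite hy.
move=> t; rewrite !inE => /eqP E.
by rewrite h0 h1 h2 k0 k1 k2 E.
Qed.

Hypothesis bireg : edge_biregular col.

Let col0 z : col (f0 z) = col z. Proof. by have [/(_ z)[]] := bireg. Qed.
Let col1 z : col (f1 z) = ~~ col z. Proof. by have [/(_ z)[]] := bireg. Qed.
Let col2 z : col (f2 z) = col z. Proof. by have [/(_ z)[]] := bireg. Qed.

(** A corner has one flag of each colour, so colour preservation turns an equation between corners
    into one between flags. *)
Lemma col_aut_corner h y z : h \in col_aut col -> col y = col z ->
  'P^*%act (corner y) h = corner z -> h y = z.
Proof.
move=> hA yz E; have : h y \in corner z.
  by rewrite -E; apply/imset_f/set21.
have [_ _ _ hc] := col_aut_flip hA.
rewrite !inE => /orP[/eqP//|/eqP hy].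
by have := hc y; rewrite hy col1 yz; case: (col z).
Qed.

Lemma col_aut_trans y z :
  exists2 h, h \in col_aut col & h y = z \/ h y = f1 z.
Proof.
have [_ tr _] := bireg.
have [|| h hA E] := atransP2 tr (x := corner y) (y := corner z).
- exact: imset_f.
- exact: imset_f.
exists h => //; have : h y \in corner z.
  by rewrite E; apply/imset_f/set21.
by rewrite !inE => /orP[]/eqP->; [left|right].
Qed.

(** Transitivity on corners determines a flag only up to [f1], which stays inside the orbit because
    [f1] belongs to [A]. *)
Lemma card_orbit_const (A : {set {perm M}}) y z :
  f1 \in A -> A \subset [set f0; f1; f2] ->
  #|orbit 'P <<A>> y| = #|orbit 'P <<A>> z|.
Proof.
move=> A1 AF; have [h hA hyz] := col_aut_trans y z.
have hC : h \in 'C(A).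
  by apply: (subsetP (centS AF)); move: hA; rewrite inE => /andP[].
rewrite -(card_orbit_cent y hC); case: hyz => ->//.
congr #|pred_of_set _|; apply/orbit_eqP.
by apply: (mem_orbit 'P); apply: mem_gen.
Qed.

(** * Counting flags on the torus *)

Hypothesis proper : proper_map M.
Hypothesis torus : on_torus M.

Lemma card_porbit_flips z :
  #|porbit (f1 * f2) z| = 4 /\ #|porbit (f0 * f1) z| = 4.
Proof.
have [[o oP] chi0] := torus.
have o0 t : o (f0 t) = ~~ o t by have [] := oP t.
have o1 t : o (f1 t) = ~~ o t by have [] := oP t.
have o2 t : o (f2 t) = ~~ o t by have [] := oP t.
have cardV t : #|orbit 'P <<[set f1; f2]>> t| = (2 * #|porbit (f1 * f2) z|)%N.
  rewrite -(card_orbit_involutions z (@flip1K M) (@flip2K M) o1 o2).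
  apply: card_orbit_const; first exact: set21.
  by apply/subsetP=> a; rewrite !inE => /orP[]->; rewrite ?orbT.
have cardF t : #|orbit 'P <<[set f0; f1]>> t| = (2 * #|porbit (f0 * f1) z|)%N.
  rewrite -(card_orbit_involutions z (@flip0K M) (@flip1K M) o0 o1).
  apply: card_orbit_const; first exact: set22.
  by apply/subsetP=> a; rewrite !inE => /orP[]->; rewrite ?orbT.
(* Properness excludes the edges with only two flags. *)
have cardE t : #|orbit 'P <<[set f0; f2]>> t| = 4.
  rewrite (card_orbit_involutions t (@flip0K M) (@flip2K M) o0 o2).
  rewrite card_porbit2 // !permM; last by rewrite -flip02C flip2K flip0K.
  apply: contra (proper t) => /eqP E; rewrite /semi_edge.
  by rewrite -[f0 t]flip2K E.
have edgesT : full_edges M = orbit 'P <<[set f0; f2]>> @: [set: M].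
  rewrite /full_edges (_ : [set t | _] = setT) //.
  by apply/setP=> t; rewrite !inE proper.
have evV : ~~ odd #|porbit (f1 * f2) z|.
  by apply: (odd_porbit (o := col)) => t; rewrite permM col2 col1.
have evF : ~~ odd #|porbit (f0 * f1) z|.
  by apply: (odd_porbit (o := col)) => t; rewrite permM col1 col0.
have T0 : 0 < #|M| by apply/card_gt0P; exists z.
have /= := card_orbits cardV; have /= := card_orbits cardF.
have /= := card_orbits cardE; rewrite -edgesT.
rewrite -/(vertices M) -/(faces M).
move: chi0; rewrite /euler_char.
move: evV evF => /even_halfK <- /even_halfK <-.
move: _./2 _./2 #|vertices M| #|faces M| #|full_edges M| #|M| T0.
move=> m n V F E T T0 chi0 ET FT VT.
have {}chi0 : V + F = E by lia.
have Vm : (V * m = V + F)%N by nia.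
have Fn : (F * n = V + F)%N by nia.
have V0 : 0 < V by case: (V) VT => //; lia.
have F0 : 0 < F by case: (F) FT => //; lia.
(* Here m and n are half the valency and half the face length. Multiplying V (m-1) = F by F (n-1) =
   V leaves (m-1)(n-1) = 1, so m = n = 2. *)
have : (m.-1 * n.-1 = 1)%N.
  have E1 : (V * m.-1 = F)%N by nia.
  have E2 : (F * n.-1 = V)%N by nia.
  by apply/eqP; rewrite -(eqn_pmul2l V0) mulnA E1 E2 muln1.
by move/eqP; rewrite muln_eq1 => /andP[/eqP ? /eqP ?]; split; lia.
Qed.

(** * The marked generators as permutations of flags *)

Variable (x : M).
Variables (r0 r2 rho0 rho2 : {perm M}).
Hypothesis gens : marked_generators col x r0 r2 rho0 rho2.
Local Notation g := (generators r0 r2 rho0 rho2).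

Lemma generators_in : [/\ r0 \in col_aut col, r2 \in col_aut col,
  rho0 \in col_aut col & rho2 \in col_aut col].
Proof. by case: gens => _ [? _] [? _] [? _] [? _]. Qed.

(** The flags [f0 (f1 x)] and [f2 (f1 x)] are unshaded; the outer [f1] passes to the shaded flag of
    the same corner. *)
Lemma generatorsE :
  [/\ r0 x = f0 x, r2 x = f2 x, rho0 x = f1 (f0 (f1 x))
    & rho2 x = f1 (f2 (f1 x))].
Proof.
have cornerC y : corner y = corner (f1 y).
  by rewrite /corner flip1K setUC.
case: gens => _ [h0 e0] [h2 e2] [k0 d0] [k2 d2].
split; apply: col_aut_corner => //; rewrite ?col1 ?col0 ?col2 ?col1 ?negbK //.
  by rewrite -cornerC.
by rewrite -cornerC.
Qed.

Lemma word_eval_in w : word_eval g w \in col_aut col.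
Proof.
have [? ? ? ?] := generators_in; apply: group_prod => -[k e] _ /=.
have gk : tnth g k \in col_aut col.
  by case: k => -[|[|[|[|//]]]] ?; rewrite (tnth_nth 1).
by case: e; rewrite ?groupV.
Qed.

(** With O the orbit of [x] under the generated subgroup, O and f1(O) together are closed under the
    flips, hence exhaust the flags. Colours force the image of [x] under any automorphism into O,
    and that image determines the automorphism. *)
Lemma generators_generate : <<[set:: g]>> = col_aut col.
Proof.
have [i0 i2 j0 j2] := generators_in; have [e0 e2 d0 d2] := generatorsE.
have gin h : h \in g -> h \in <<[set:: g]>>.
  by move=> hg; apply: mem_gen; rewrite inE.
have subA : <<[set:: g]>> \subset col_aut col.
  rewrite gen_subG; apply/subsetP=> h.
  rewrite in_set => hg; have {hg} : h \in [:: r0; r2; rho0; rho2] := hg.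
  by rewrite !in_cons orbF => /or4P[] /eqP->.
apply/eqP; rewrite eqEsubset subA; apply/subsetP=> h hA.
pose O := orbit 'P <<[set:: g]>> x.
(* For z = k x, [f0 z] is k (f0 x) = k (r0 x), again in the orbit; the other three are similar. *)
have flipO z : z \in O -> [/\ f0 z \in O, f2 z \in O,
     f1 (f0 (f1 z)) \in O & f1 (f2 (f1 z)) \in O].
  case/orbitP=> k kG <-; rewrite /= /aperm.
  have [k0 k1 k2 _] := col_aut_flip (subsetP subA _ kG).
  rewrite -!(k0, k1, k2) -e0 -e2 -d0 -d2 -!permM.
  by split; apply: (mem_orbit 'P); rewrite groupM // gin // !inE eqxx ?orbT.
have full := @flip_closed_full (O :|: f1 @: O) x.
have mem1 z : (z \in f1 @: O) = (f1 z \in O).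
  by rewrite -{1}[z]flip1K mem_imset //; apply: perm_inj.
have colO z : z \in O -> col z = col x.
  case/orbitP=> k kG <-.
  by have [_ _ _ ->] := col_aut_flip (subsetP subA _ kG).
have hx : h x \in O.
  have: h x \in O :|: f1 @: O.
    apply: full => [|z]; first by rewrite inE orbit_refl.
    rewrite !(in_setU, mem1) flip1K => /orP[zO|zO].
      by have [z0 z2 _ _] := flipO _ zO; rewrite z0 z2 zO orbT.
    have [_ _] := flipO _ zO; rewrite flip1K => z0 z2.
    by rewrite z0 z2 zO !orbT.
  rewrite inE mem1 => /orP[//|/colO].
  have [_ _ _ hc] := col_aut_flip hA.
  by rewrite col1 hc; case: (col x).
case/orbitP: hx => k kG kx.
by rewrite (col_aut_eq hA (subsetP subA _ kG) (esym kx)).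
Qed.

(** Each generator moves [x] by one or three flips, so every letter of a word reverses
    orientation. *)
Lemma even_size_of_eval1 w : word_eval g w = 1 -> ~~ odd (size w).
Proof.
have [i0 i2 j0 j2] := generators_in; have [e0 e2 d0 d2] := generatorsE.
have [[o oP] _] := torus.
have o0 t : o (f0 t) = ~~ o t by have [] := oP t.
have o1 t : o (f1 t) = ~~ o t by have [] := oP t.
have o2 t : o (f2 t) = ~~ o t by have [] := oP t.
(* Reversal at [x] spreads to all flags, as automorphisms commute with the flips. *)
have oh h : h \in col_aut col -> o (h x) = ~~ o x -> forall z, o (h z) = ~~ o z.
  case/col_aut_flip=> h0 h1 h2 _ hx z.
  have := @flip_closed_full [set t | o (h t) == ~~ o t] x _ _ z.
  rewrite !inE => clo; apply/eqP/clo; first by rewrite hx.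
  by move=> t; rewrite !inE h0 h1 h2 !(o0, o1, o2) => /eqP->.
have og (i : 'I_4) z : o (tnth g i z) = ~~ o z.
  case: i => -[|[|[|[|//]]]] ?; rewrite (tnth_nth 1) /=; apply: oh => //.
  - by rewrite e0.
  - by rewrite e2.
  - by rewrite d0 !(o0, o1) negbK.
  - by rewrite d2 !(o2, o1) negbK.
have ow : forall z, o (word_eval g w z) = odd (size w) (+) o z.
  elim: w => [|[k e] w IHw] z; first by rewrite /word_eval big_nil perm1.
  rewrite -cat1s word_eval_cat permM IHw /= /word_eval big_seq1 /=.
  case: e; last by rewrite og addbN addNb.
  by rewrite -{2}[z](permKV (tnth g k)) og addbN addNb negbK.
by move=> w1; have := ow x; rewrite w1 perm1; case: odd => //=; case: (o x).
Qed.

(** It suffices to test at [x], where words unwind to flips. [(r0 * rho0) ^+ 2] and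
    [(r2 * rho2) ^+ 2] become closed walks round a face and a vertex. *)
Lemma eval_relators44 w : w \in relators44 -> word_eval g w = 1.
Proof.
have [i0 i2 j0 j2] := generators_in; have [e0 e2 d0 d2] := generatorsE.
have f12 : f2 (f1 (f2 (f1 (f2 (f1 (f2 (f1 x))))))) = x.
  have := iter_porbit (f1 * f2) x; have [-> _] := card_porbit_flips x.
  by rewrite /= !permM.
have f01 : f0 (f1 (f0 (f1 (f0 (f1 (f0 (f1 x))))))) = x.
  (* Starting from [f1 x] puts an [f1] in front on both sides, which then cancels. *)
  have := iter_porbit (f0 * f1) (f1 x).
  have [_ ->] := card_porbit_flips (f1 x).
  by rewrite /= !permM => /perm_inj.
have [h00 h01 h02 _] := col_aut_flip i0.
have [h20 h21 h22 _] := col_aut_flip i2.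
have [k00 k01 k02 _] := col_aut_flip j0.
have [k20 k21 k22 _] := col_aut_flip j2.
pose E := (h00, h01, h02, h20, h21, h22, k00, k01, k02, k20, k21, k22,
           (e0, e2, d0, d2), (flip0K, flip1K, flip2K)).
have ev1 u : word_eval g u x = x -> word_eval g u = 1.
  move=> ux; apply: (col_aut_eq (y := x)); rewrite ?word_eval_in ?group1 //.
  by rewrite perm1.
rewrite !in_cons orbF => wR; apply: ev1; move: wR.
do 7?[case/predU1P=> [->|]]; rewrite ?orbF; try move/eqP->.
all: rewrite !(word_eval_pow, word_eval_cat, word_eval_letter) !(tnth_nth 1) /=.
all: rewrite ?expgS expg0 mulg1 !permM.
all: by rewrite !E // !flip02C !E.
Qed.

(** The first two equalities would create a semi-edge at [x] or [f1 x]; the last two would close the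
    cycle round a face or a vertex after two steps instead of four. *)
Lemma generators_neq : [/\ r0 != r2, rho0 != rho2, r0 != rho0 & r2 != rho2].
Proof.
have [e0 e2 d0 d2] := generatorsE.
have [cV cF] := card_porbit_flips x.
split; apply/eqP=> E.
- by have := proper x; rewrite /semi_edge -e0 -e2 E eqxx.
- have := proper (f1 x); rewrite /semi_edge -(inj_eq (@perm_inj _ f1)).
  by rewrite -d0 -d2 E eqxx.
- have := uniq_traject_porbit (f0 * f1) x; rewrite cF /= !permM.
  by rewrite -e0 E d0 flip1K flip0K flip1K !inE eqxx !orbT.
- have := uniq_traject_porbit (f1 * f2) x; rewrite cV /= !permM.
  by rewrite -d2 -E e2 flip2K !inE eqxx !orbT.
Qed.

End ToroidalMap.

Theorem proposition4p3 (M : surface_map) (col : M -> bool) (x : M)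
    (r0 r2 rho0 rho2 : {perm M}) :
  edge_biregular col ->
  proper_map M ->
  on_torus M ->
  marked_generators col x r0 r2 rho0 rho2 ->
  up_to_duality_and_twinness
    (fun g : 4.-tuple {perm M} =>
       (exists a c : nat, 0 < a /\ 0 < c /\
          presented_by (col_aut col) g (relators_rect a c)) \/
       (exists b c : nat, 0 < b /\ 0 < c /\
          presented_by (col_aut col) g (relators_rhomb b c)))
    r0 r2 rho0 rho2.
Proof.
(* The presentation is obtained for the generators in their given order, the first of the four
   alternatives. *)
move=> bireg proper torus gens; constructor 1.
have [n02 nr02 n00 n22] := generators_neq bireg proper torus gens.
have [[a [c [a0 c0 P]]]|[b [c [b0 c0 P]]]] :=
  presentation44 (eval_relators44 bireg proper torus gens)
    (even_size_of_eval1 bireg torus gens) n02 nr02 n00 n22.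
  left; exists a, c; do 3!split=> //; exact: generators_generate gens.
right; exists b, c; do 3!split=> //; exact: generators_generate gens.
Qed.
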